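(* Let $K$ be a bounded subset of $L_1(0,1)$. Then the following two conditions are equivalent: (i) there exists an Orlicz function $G$ with $\frac{G(t)}{t}\to\infty$ as $t\to\infty$ such that $$\sup\left\{\int_0^1 G(|f(s)|)\,ds:\ f\in K\right\}<\infty;$$ (ii) there exists a positive function $g\in L_1(0,1)$ such that $|f|\prec\prec g$ for all $f\in K$, that is, $K$ is contained in the orbit $\mathcal{C}_g$ of $g$.
   Context: The interval $(0,1)$ is equipped with Lebesgue measure $m$; functions are real-valued and measurable, and ''bounded'' means bounded in the $L_1$-norm. Orlicz function: a function $G:[0,\infty)\to[0,\infty]$ such that $G(0)=0$, $G$ is not identically zero, $G$ is convex, and $G$ is continuous at zero. Decreasing rearrangement: for a measurable function $f$ on $(0,1)$, $\mu(t,f)=\inf\{s\ge 0:\ m(\{|f|>s\})\le t\}$ for $t\ge 0$. Submajorization in the sense of Hardy–Littlewood–Pólya: $f\prec\prec g$ means $\int_0^t\mu(s,f)\,ds\le\int_0^t\mu(s,g)\,ds$ for all $t\ge 0$. Orbit: for a positive $g\in L_1(0,1)$, $\mathcal{C}_g=\{f\in L_1(0,1):\ |f|\prec\prec g\}$. *)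

(* Defs.v *)
From HB Require Import structures.
From mathcomp Require Import all_boot all_order all_algebra.
From mathcomp Require Import all_classical all_reals all_analysis.

Set Implicit Arguments.
Unset Strict Implicit.
Unset Printing Implicit Defensive.

Import Order.TTheory GRing.Theory Num.Theory.
Import numFieldNormedType.Exports.

Local Open Scope classical_set_scope.
Local Open Scope ring_scope.

(* A function on (0,1) is represented by a total function R -> R; every
   definition below only looks at its values on `]0, 1[. *)

Definition L1 (R : realType) : set (R -> R) :=
  [set f | (@lebesgue_measure R).-integrable `]0, 1[ (EFin \o f)].

Definition L1norm (R : realType) (f : R -> R) : \bar R :=
  (\int[@lebesgue_measure R]_(s in `]0%R, 1%R[) `|f s|%R%:E)%E.

Definition L1bounded (R : realType) (K : set (R -> R)) : Prop :=
  exists M : R, forall f, K f -> (L1norm f <= M%:E)%E.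

(* [0, oo] is encoded as nonnegative extended reals, with G : R -> \bar R only
   constrained on nonnegative arguments.  In the convexity inequality
   0 * +oo = 0. *)
Definition orlicz (R : realType) (G : R -> \bar R) : Prop :=
  [/\ (forall t, 0 <= t -> (0 <= G t)%E),
      G 0 = 0%E,
      (exists2 t, 0 <= t & G t <> 0%E),
      (forall x y l : R, 0 <= x -> 0 <= y -> 0 <= l -> l <= 1 ->
        (G (l * x + (1 - l) * y)%R
           <= l%:E * G x + (1 - l)%R%:E * G y)%E) &
      G t @[t --> (0 : R)^'+] --> G 0].

(* The infimum is taken in \bar R: at t = 0 the set is empty, and the value is
   +oo, when f is essentially unbounded. *)
Definition rearrangement (R : realType) (t : R) (f : R -> R) : \bar R :=
  ereal_inf [set s%:E | s in
    [set s : R | 0 <= s /\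
      (lebesgue_measure [set x : R | `]0%R, 1%R[%classic x /\ (s < `|f x|)%R]
         <= t%:E)%E]].

Definition submajorized (R : realType) (f g : R -> R) : Prop :=
  forall t : R, 0 <= t ->
    (\int[@lebesgue_measure R]_(s in `]0%R, t[) rearrangement s f
       <= \int[@lebesgue_measure R]_(s in `]0%R, t[) rearrangement s g)%E.

Definition hlp_orbit (R : realType) (g : R -> R) : set (R -> R) :=
  [set f | L1 f /\ submajorized (fun x => `|f x|) g].

(* Main.v *)
(* Both conditions are equivalent to uniform integrability of [K], in the form:
   the integrals of (|f| - l)_+ tend to 0 as l -> oo, uniformly in f.
   Exchanging the order of integration in the layer cake formula gives, writing
   mu for the decreasing rearrangement,
     int_0^t mu(s, f) ds <= l t + int (|f| - l)_+   for all l, t >= 0, and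
     int_E |f| <= int_0^t mu(s, f) ds               whenever m(E) <= t,
   with equality in both when E = {|f| > l} and t = m(E).  Hence int (|f| - l)_+ <=
   int (|g| - l)_+ if g submajorizes |f|.  Conversely, if int (|f| - l_n)_+ <= c_n
   for all f in K and the c_n are summable, then G(u) = sum_n (u - l_n)_+ is an
   Orlicz function as required, and a majorant g is a sum of step functions
   a_n 1_(0, b_n) with a_n b_n = c_n. *)

Require Import Defs.
From HB Require Import structures.
From mathcomp Require Import all_boot all_order all_algebra.
From mathcomp Require Import all_classical all_reals all_analysis.
From mathcomp Require Import measurable_realfun lra.

Import Order.TTheory GRing.Theory Num.Theory.
Import numFieldNormedType.Exports.

Local Open Scope classical_set_scope.
Local Open Scope ring_scope.

Section HardyLittlewoodPolyaOrbits.
Context {R : realType}.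
Set Implicit Arguments.
Unset Strict Implicit.
Local Notation leb := (@lebesgue_measure R).
Local Notation I := (`]0%R, 1%R[%classic : set R).
Implicit Types (E : set R) (f g h : R -> R) (s t r l : R) (K : set (R -> R)).

(** * The layer cake formula *)

(** By Tonelli for the indicator of [A], both sides are its product measure. *)
Lemma measure_sections (A : set (R * R)) : measurable A ->
  (\int[leb]_x leb (xsection A x) = \int[leb]_y leb (ysection A y))%E.
Proof.
move=> mA; have := indic_fubini_tonelli leb leb mA.
by rewrite indic_fubini_tonelli_FE// indic_fubini_tonelli_GE.
Qed.

Lemma measurable_lt_snd (E : set R) (h : R -> R) : measurable E ->
  measurable_fun E h -> measurable [set p : R * R | E p.1 /\ p.2 < h p.1].
Proof.
move=> mE mh.
have mh' : measurable_fun setT (h \_ E) by apply/(measurable_restrictT _ _).1.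
have -> : [set p : R * R | E p.1 /\ p.2 < h p.1] =
    (E `*` setT) `&` ((fun p : R * R => p.2 < (h \_ E) p.1) @^-1` [set true]).
  apply/seteqP; split => -[x r] /= [].
    by move=> Ex rh; split => //; rewrite patchE mem_set.
  by move=> [Ex _]; rewrite patchE mem_set.
apply: measurableI; first exact: measurableX.
rewrite -[X in measurable X]setTI.
apply: measurable_fun_ltr => //; exact: measurableT_comp.
Qed.

Lemma measurable_lt_EFin (J : set R) (c : \bar R) : measurable J ->
  measurable [set s | J s /\ (s%:E < c)%E].
Proof.
move=> mJ.
have -> : [set s : R | J s /\ (s%:E < c)%E] =
    J `&` [set s | (EFin s < cst c s)%E] by [].
by apply: measurable_lte => //; exact: measurable_funTS.
Qed.

(** The distribution function of [h] on [E]; for a signed function it is applied to the absolute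
    value. *)
Definition tail (E : set R) (h : R -> R) (r : R) : \bar R :=
  leb [set x | E x /\ r < h x].

Lemma measurable_level (E : set R) (h : R -> R) : measurable E ->
  measurable_fun E h -> forall r, measurable [set x | E x /\ r < h x].
Proof.
move=> mE mh r; have := measurable_ysection r (measurable_lt_snd mE mh).
by rewrite ysectionE.
Qed.

Lemma measurable_tail (E : set R) (h : R -> R) : measurable E ->
  measurable_fun E h ->
  measurable_fun setT (tail E h).
Proof.
move=> mE mh; have := measurable_fun_ysection leb (measurable_lt_snd mE mh).
by apply: eq_measurable_fun => r _; rewrite /= ysectionE.
Qed.

Lemma tail_ge0 E h r : (0 <= tail E h r)%E.
Proof. exact: measure_ge0. Qed.

Lemma tail_le E h r : measurable E -> measurable_fun E h ->
  (tail E h r <= leb E)%E.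
Proof.
move=> mE mh; apply: le_measure; rewrite ?inE//; first exact: measurable_level.
by move=> x [].
Qed.

Lemma lebesgue_measure_itv0 r : 0 <= r -> leb `]0%R, r[%classic = r%:E.
Proof.
move=> r0; rewrite lebesgue_measure_itv/= lte_fin oppr0 adde0.
by case: ifPn => //; rewrite -leNgt => r0'; congr EFin; apply/eqP; rewrite eq_le r0 r0'.
Qed.

(** Turns a nonnegative extended real into the length of a section, so that [measure_sections]
    applies and inequalities reduce to inclusions. *)
Lemma lebesgue_measure_lt_ereal (m : \bar R) : (0 <= m)%E ->
  leb [set r | 0 <= r /\ (r%:E < m)%E] = m.
Proof.
case: m => [m|_|//].
  rewrite lee_fin => m0; have -> : [set r | 0 <= r /\ (r%:E < m%:E)%E] = `[0, m[%classic.
    by apply/seteqP; split => r /=; rewrite in_itv/= lte_fin => /andP.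
  rewrite lebesgue_measure_itv/= lte_fin oppr0 adde0.
  by case: ltgtP m0 => // <-.
have -> : [set r : R | 0 <= r /\ (r%:E < +oo)%E] = `[0, +oo[%classic.
  by apply/seteqP; split => r /=; rewrite in_itv/= ltry andbT => // -[].
by rewrite lebesgue_measure_itv/= ltry.
Qed.

(** The region 0 <= r < h(x) over [E] has sections of length h(x) in one direction and of measure
    [tail E h r] in the other. *)
Lemma layer_cake (E : set R) (h : R -> R) : measurable E ->
  measurable_fun E h -> (forall x, E x -> 0 <= h x) ->
  (\int[leb]_(x in E) (h x)%:E =
   \int[leb]_(r in `[0%R, +oo[) tail E h r)%E.
Proof.
move=> mE mh h0; pose A := [set p : R * R | E p.1 /\ p.2 < h p.1] `&`
  (setT `*` `[0%R, +oo[%classic).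
have mA : measurable A.
  by apply: measurableI; [exact: measurable_lt_snd|exact: measurableX].
have AE := measure_sections mA.
rewrite [LHS]integral_mkcond [RHS]integral_mkcond.
transitivity (\int[leb]_x leb (xsection A x))%E.
  apply: eq_integral => x _; rewrite patchE xsectionE /A.
  case: ifPn => [/set_mem Ex|/negP xE].
    rewrite -[LHS]lebesgue_measure_lt_ereal ?lee_fin ?h0//.
    congr (leb _); apply/seteqP; split => r /=; rewrite in_itv/= lte_fin andbT.
      by move=> [].
    by move=> [[_ rh] [_ r0]].
  rewrite -[LHS](measure0 leb); congr (leb _).
  by apply/seteqP; split => r // [[Ex _] _]; case: xE; exact: mem_set.
rewrite AE; apply: eq_integral => r _; rewrite patchE ysectionE /A.
case: ifPn => [/set_mem r0|/negP r0].
  by congr (leb _); apply/seteqP; split => x /= => [[]|].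
rewrite -[RHS](measure0 leb); congr (leb _).
by apply/seteqP; split => x // [_ [_ r0']]; case: r0; exact: mem_set.
Qed.

(** * Decreasing rearrangements *)

Lemma rearrangement_ge0 s f : (0 <= rearrangement s f)%E.
Proof. by apply: le_ereal_inf_tmp => _ [r [r0 _]] <-; rewrite lee_fin. Qed.

Lemma rearrangement_abs s f :
  rearrangement s (fun x => `|f x|) = rearrangement s f.
Proof.
rewrite /rearrangement; congr (ereal_inf (image _ _)); apply/funext => r.
congr (_ /\ (leb _ <= _)%E); apply/funext => x.
by rewrite /mkset normr_id.
Qed.

(* The set on the right-hand side is an initial segment of [0, oo) with supremum
   [rearrangement s f]; whether the supremum belongs to it does not matter, so
   right-continuity of the distribution function is not needed. *)
Lemma rearrangement_decreasing_inverse s f : measurable_fun I f ->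
  rearrangement s f =
  leb [set r | 0 <= r /\ (s%:E < tail I (fun x => `|f x|)%R r)%E].
Proof.
move=> mf; have mI : measurable I by exact: measurable_itv.
have maf : measurable_fun I (fun x => `|f x|) by exact: measurableT_comp.
set d := tail _ _.
have md : measurable_fun setT d by exact: measurable_tail.
have mS : measurable [set r : R | 0 <= r /\ (s%:E < d r)%E].
  have -> : [set r : R | 0 <= r /\ (s%:E < d r)%E] =
      `[0%R, +oo[%classic `&` [set r | (cst s%:E r < d r)%E].
    by apply/seteqP; split => r /=; rewrite in_itv/= andbT => -[].
  by apply: measurable_lte => //; exact: measurable_funTS.
apply/eqP; rewrite eq_le; apply/andP; split.
  rewrite -[leLHS](lebesgue_measure_lt_ereal (rearrangement_ge0 s f)).
  apply: le_measure; rewrite ?inE//.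
    have := measurable_lt_EFin (rearrangement s f) (measurable_itv `[0%R, +oo[).
    by congr measurable; apply/seteqP; split => r /=; rewrite in_itv/= andbT.
  move=> r [r0 rlt]; split => //; rewrite ltNge; apply/negP => drs.
  move: rlt; rewrite ltNge => /negP; apply.
  by apply: ereal_inf_lbound; exists r.
apply: le_ereal_inf_tmp => _ [r [r0 drs]] <-.
apply: (@le_trans _ _ (leb `[0%R, r[%classic)); last first.
  by rewrite lebesgue_measure_itv/= oppr0 adde0; case: ifPn; rewrite ?lee_fin.
apply: le_measure; rewrite ?inE//.
move=> u [/= u0 su]; rewrite in_itv/= u0/= ltNge; apply/negP => ru.
move: su; rewrite ltNge => /negP; apply; apply: le_trans drs.
apply: le_measure; rewrite ?inE; try exact: measurable_level.
by move=> x /= [Ix ux]; split => //; exact: le_lt_trans ux.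
Qed.

(** The region under the decreasing rearrangement over (0, t), written through the distribution
    function, whose measurability is known. *)
Lemma measurable_rearrangement_graph f t : measurable_fun I f ->
  measurable [set p : R * R | `]0, t[%classic p.1 /\ 0 <= p.2 /\
     (p.1%:E < tail I (fun x => `|f x|)%R p.2)%E].
Proof.
move=> mf; have mI : measurable I by exact: measurable_itv.
have maf : measurable_fun I (fun x => `|f x|) by exact: measurableT_comp.
have -> : [set p : R * R | `]0, t[%classic p.1 /\ 0 <= p.2 /\
     (p.1%:E < tail I (fun x => `|f x|)%R p.2)%E] =
   (`]0, t[%classic `*` `[0%R, +oo[%classic) `&`
   [set p | (p.1%:E < tail I (fun x => `|f x|)%R p.2)%E].
  apply/seteqP; split => -[x r] /=; rewrite !in_itv/= andbT.
    by move=> [? []].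
  by move=> [[]].
apply: measurable_lte; first exact: measurableX.
  by apply/measurable_EFinP/measurable_funTS.
by apply/measurable_funTS/measurableT_comp => //; exact: measurable_tail.
Qed.

Lemma measurable_rearrangement f t : measurable_fun I f ->
  measurable_fun `]0, t[ (fun s => rearrangement s f).
Proof.
move=> mf; have := measurable_fun_xsection leb (measurable_rearrangement_graph t mf).
move=> /measurable_funTS H; apply: eq_measurable_fun (H `]0, t[%classic).
move=> s /set_mem st; rewrite (rearrangement_decreasing_inverse s mf) /=.
by rewrite xsectionE; congr (leb _); apply/seteqP; split => r //= [].
Qed.

(** Tonelli on that region. For t >= 0 the integrand on the right is the minimum of t and the
    distribution function at r. *)
Lemma integral_rearrangement f t : measurable_fun I f ->
  (\int[leb]_(s in `]0%R, t[) rearrangement s f =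
   \int[leb]_(r in `[0%R, +oo[) leb [set s | `]0%R, t[%classic s /\
     (s%:E < tail I (fun x => `|f x|)%R r)%E])%E.
Proof.
move=> mf; have mA := measurable_rearrangement_graph t mf.
have := measure_sections mA; set A := (X in xsection X) => AE.
rewrite [LHS]integral_mkcond [RHS]integral_mkcond.
transitivity (\int[leb]_x leb (xsection A x))%E.
  apply: eq_integral => s _; rewrite patchE xsectionE /A.
  case: ifPn => [/set_mem/= st|/negP st].
    rewrite (rearrangement_decreasing_inverse s mf).
    congr (leb _); apply/seteqP; split => r /= => [|[]//].
      exact: conj.
  rewrite -[LHS](measure0 leb); congr (leb _).
  by apply/seteqP; split=> [r []|r [st' _]]; case: st; exact: mem_set.
rewrite AE; apply: eq_integral => r _; rewrite patchE ysectionE /A.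
case: ifPn => [/set_mem/=|/negP r0].
  rewrite in_itv/= andbT => r0.
  congr (leb _); apply/seteqP; split => s /=.
    by move=> [st [_ sd]]; exact: conj st sd.
  by move=> [st sd]; exact: conj st (conj r0 sd).
rewrite -[RHS](measure0 leb); congr (leb _).
apply/seteqP; split => [s [_ [r0' _]]|s []]; case: r0; apply: mem_set.
by rewrite /= in_itv/= r0'.
Qed.

(** * Excess over a level *)

(** The integral of a nonnegative function is a supremum over the simple functions below it, and a
    larger integrand has more of them. This covers G(|f|), whose measurability is not at hand. *)
Lemma ge0_le_integral_nonmeasurable d (T : measurableType d)
    (mu : {measure set T -> \bar R}) (D : set T) (f1 f2 : T -> \bar R) :
  (forall x, D x -> (0 <= f1 x)%E) -> (forall x, D x -> (f1 x <= f2 x)%E) ->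
  (\int[mu]_(x in D) f1 x <= \int[mu]_(x in D) f2 x)%E.
Proof.
move=> f10 f12; rewrite integral_mkcond [leRHS]integral_mkcond.
have f20 x : D x -> (0 <= f2 x)%E by move=> Dx; exact: le_trans (f10 _ Dx) (f12 _ Dx).
rewrite !ge0_integralTE; [|exact: erestrict_ge0..].
apply: ereal_sup_le => _ [h /= hf1 <-]; exists h => //= x.
by apply: le_trans (hf1 x) _; rewrite !patchE; case: ifPn => // /set_mem /f12.
Qed.

Definition excess f l : R -> R := fun x => Num.max (`|f x| - l) 0.

Lemma excess_ge0 f l x : 0 <= excess f l x.
Proof. by rewrite le_max lexx orbT. Qed.

Lemma measurable_excess (E : set R) f l : measurable_fun E f ->
  measurable_fun E (excess f l).
Proof.
move=> mf; apply: measurable_maxr => //; apply: measurable_funB => //.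
exact: measurableT_comp.
Qed.

(** For r >= 0 the sets {|f| > l + r} and {excess > r} coincide, so each level r admissible for the
    excess makes l + r admissible for [f]. *)
Lemma rearrangement_le_excess s f l : 0 <= l ->
  (rearrangement s f <= l%:E + rearrangement s (excess f l))%E.
Proof.
move=> l0; rewrite -leeBlDl//; apply: le_ereal_inf_tmp => _ [r [r0 Hr]] <-.
rewrite leeBlDl//; apply: ereal_inf_lbound; exists (l + r); last by rewrite EFinD.
split; first exact: addr_ge0.
apply: le_trans Hr; rewrite le_eqVlt; apply/orP; left; apply/eqP; congr (leb _).
apply/seteqP; split => x /= [Ix H]; split => //.
  by rewrite ger0_norm ?excess_ge0// lt_max ltrBrDl H.
by move: H; rewrite ger0_norm ?excess_ge0// lt_max ltrBrDl ltNge r0 orbF.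
Qed.

Lemma integral_rearrangement_le f t l : measurable_fun I f -> 0 <= l -> 0 <= t ->
  (\int[leb]_(s in `]0%R, t[) rearrangement s f <=
   (l * t)%:E + \int[leb]_(x in `]0%R, 1%R[) (excess f l x)%:E)%E.
Proof.
move=> mf l0 t0; have mh := measurable_excess l mf.
apply: (@le_trans _ _
  (\int[leb]_(s in `]0%R, t[) (l%:E + rearrangement s (excess f l)))%E).
  apply: ge0_le_integral_nonmeasurable => s _; first exact: rearrangement_ge0.
  exact: rearrangement_le_excess.
rewrite ge0_integralD//; [|by move=> s _; exact: rearrangement_ge0|
  exact: measurable_rearrangement].
apply: leeD.
  by rewrite integral_cst//= lebesgue_measure_itv0// EFinM.
(* Both sides become integrals over levels r: the minimum of t and the distribution function of the
   excess, against that function itself. *)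
rewrite integral_rearrangement// layer_cake//; last by move=> x _; exact: excess_ge0.
have eh : (fun x => `|excess f l x|) = excess f l.
  by apply/funext => x; rewrite ger0_norm ?excess_ge0.
rewrite eh; apply: ge0_le_integral_nonmeasurable => // r _.
rewrite -[leRHS](lebesgue_measure_lt_ereal (tail_ge0 _ _ _)).
apply: le_measure; rewrite ?inE.
- by apply: measurable_lt_EFin; exact: measurable_itv.
- have := measurable_lt_EFin (tail I (excess f l) r) (measurable_itv `[0%R, +oo[).
  by congr measurable; apply/seteqP; split => s /=; rewrite in_itv/= andbT.
- by move=> s /= [+ ?]; rewrite in_itv/= => /andP[/ltW].
Qed.

(** Level by level, the distribution function of |f| on [E] is at most m(E) <= t and at most the one
    on (0, 1), hence at most their minimum. *)
Lemma integral_le_rearrangement f t (E : set R) : measurable_fun I f ->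
  measurable E -> E `<=` I -> (leb E <= t%:E)%E ->
  (\int[leb]_(x in E) `|f x|%:E <= \int[leb]_(s in `]0%R, t[) rearrangement s f)%E.
Proof.
move=> mf mE EI Et; have mI : measurable I by exact: measurable_itv.
have mfE : measurable_fun E (fun x => `|f x|).
  by apply: measurableT_comp => //; exact: measurable_funS mf.
rewrite layer_cake// integral_rearrangement//.
apply: ge0_le_integral_nonmeasurable => r _; first exact: tail_ge0.
set v := tail E _ r; set c := tail I _ r.
have vt : (v <= t%:E)%E by exact: le_trans (tail_le _ _ _) Et.
have vc : (v <= c)%E.
  apply: le_measure; rewrite ?inE; try exact: measurable_level.
    by apply: measurable_level => //; exact: measurableT_comp.
  by move=> x [/EI].
have v0 : (0 <= v)%E by exact: tail_ge0.
have vfin : v \is a fin_num by rewrite ge0_fin_numE// (le_lt_trans vt)// ltry.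
have -> : v = leb `]0%R, (fine v)[%classic.
  by rewrite lebesgue_measure_itv0 ?fineK// fine_ge0.
apply: le_measure; rewrite ?inE//.
  by apply: measurable_lt_EFin; exact: measurable_itv.
move=> s /=; rewrite !in_itv/= => /andP[s0 sv]; rewrite s0/=; split.
  by rewrite -lte_fin (lt_le_trans _ vt)// -(fineK vfin) lte_fin.
by rewrite (lt_le_trans _ vc)// -(fineK vfin) lte_fin.
Qed.

(** * Uniform integrability and Orlicz functions *)

(** One level per [e] is enough, because the integral of the excess decreases as the level grows. *)
Definition unif_integrable K : Prop := forall e : R, 0 < e ->
  exists2 l, 0 <= l & forall f, K f ->
    (\int[leb]_(x in `]0%R, 1%R[) (excess f l x)%:E <= e%:E)%E.

Lemma measurable_L1 f : L1 f -> measurable_fun I f.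
Proof. by move=> /measurable_int /measurable_EFinP. Qed.

Lemma excess_antitone f l l' x : l <= l' -> excess f l' x <= excess f l x.
Proof. by move=> ll'; rewrite /excess ge_max !le_max lexx orbT andbT lerB. Qed.

Lemma excess0 f x : excess f 0 x = `|f x|.
Proof. by rewrite /excess subr0; apply/max_idPl. Qed.

Lemma integral_excess_antitone f l l' : l <= l' ->
  (\int[leb]_(x in `]0%R, 1%R[) (excess f l' x)%:E <=
   \int[leb]_(x in `]0%R, 1%R[) (excess f l x)%:E)%E.
Proof.
move=> ll'; apply: ge0_le_integral_nonmeasurable => x _.
  by rewrite lee_fin excess_ge0.
by rewrite lee_fin excess_antitone.
Qed.

(** Let C bound the integrals of G(|f|). Beyond some T, G(t)/t >= C/e, so G(t) >= (C/e)(t - T)_+ for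
    all t >= 0; integrating and dividing by C/e leaves e. *)
Lemma orlicz_unif_integrable K (G : R -> \bar R) : K `<=` @L1 R ->
  orlicz G -> (G t * (t^-1)%:E)%E @[t --> +oo%R] --> +oo%E ->
  (ereal_sup [set \int[leb]_(s in `]0%R, 1%R[) G `|f s|%R | f in K] < +oo)%E ->
  unif_integrable K.
Proof.
move=> KL1 [G0 _ _ _ _] Goo Gsup e e0.
have [C C0 GC] : exists2 C, 0 < C & forall f, K f ->
    (\int[leb]_(s in `]0%R, 1%R[) G `|f s|%R <= C%:E)%E.
  move: Gsup; set S := ereal_sup _ => Soo.
  (* The added 1 makes C/e positive; [fine] sends the supremum -oo of an empty family to 0. *)
  exists (`|fine S| + 1); first by rewrite ltr_wpDl.
  move=> f Kf; apply: (@le_trans _ _ S); first by apply: ereal_sup_ubound; exists f.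
  move: Soo; case: (S) => [u _|//|_]; last by rewrite leNye.
  by rewrite lee_fin /= (le_trans (ler_norm u))// lerDl.
move/cvgeyPge/(_ (C / e)) : Goo => [T0 [_ HT0]].
(* A positive T makes every t > T positive, so the bound on G(t)/t can be multiplied by t. *)
pose T := `|T0| + 1.
have T_gt0 : 0 < T by rewrite ltr_wpDl.
exists T; first exact: ltW.
move=> f Kf; have Ce : 0 < C / e by rewrite divr_gt0.
have Gle t : 0 <= t -> ((C / e * Num.max (t - T) 0)%:E <= G t)%E.
  move=> t0; have [tT|Tt] := leP t T.
    by rewrite (max_idPr _) ?subr_le0// mulr0 G0.
  have t_gt0 : 0 < t by exact: lt_trans Tt.
  have : ((C / e)%:E <= G t * (t^-1)%:E)%E.
    by apply: HT0; rewrite (le_lt_trans _ Tt)// (le_trans (ler_norm _))// lerDl.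
  rewrite lee_pdivlMr// -EFinM; apply: le_trans.
  rewrite lee_fin ler_pM2l// ge_max (ltW t_gt0) andbT lerBlDr lerDl.
  exact: ltW.
have mf := measurable_L1 (KL1 _ Kf).
have : ((C / e)%:E * \int[leb]_(x in `]0%R, 1%R[) (excess f T x)%:E <= C%:E)%E.
  rewrite -ge0_integralZl//; last 3 first.
  - by apply/measurable_EFinP; exact: measurable_excess.
  - by move=> x _; rewrite lee_fin excess_ge0.
  - by rewrite lee_fin ltW.
  apply: le_trans (GC _ Kf); apply: ge0_le_integral_nonmeasurable => x _.
    by rewrite -EFinM lee_fin mulr_ge0 ?excess_ge0// ltW.
  by rewrite -EFinM Gle.
rewrite muleC -lee_pdivlMr// -EFinM => /le_trans; apply.
by rewrite lee_fin invf_div mulrCA divff ?mulr1 ?gt_eqF.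
Qed.

(** The bounds e / 2^(n+1) sum to e; these levels feed the constructions of both [G] and [g]. *)
Lemma unif_integrable_seq K e : unif_integrable K -> 0 < e ->
  exists l : nat -> R, forall n, 0 <= l n /\ forall f, K f ->
    (\int[leb]_(x in `]0%R, 1%R[) (excess f (l n) x)%:E <=
      (e / (2 ^ n.+1)%:R)%:E)%E.
Proof.
move=> UK e0.
have /choice[l Hl] : forall n, exists l, 0 <= l /\ forall f, K f ->
    (\int[leb]_(x in `]0%R, 1%R[) (excess f l x)%:E <=
      (e / (2 ^ n.+1)%:R)%:E)%E.
  move=> n; have [|l l0 Hl] := UK (e / (2 ^ n.+1)%:R); last by exists l.
  by rewrite divr_gt0// ltr0n expn_gt0.
by exists l.
Qed.

Lemma unif_integrable_orlicz K : K `<=` @L1 R -> unif_integrable K ->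
  exists G : R -> \bar R,
    [/\ orlicz G,
        (G t * (t^-1)%:E)%E @[t --> +oo%R] --> +oo%E &
        (ereal_sup
           [set \int[leb]_(s in `]0%R, 1%R[) G `|f s|%R | f in K] < +oo)%E].
Proof.
move=> KL1 /unif_integrable_seq/(_ ltr01)[l' Hl'].
(* Levels of at least 1 make [G] vanish on [0, 1], which yields both G(0) = 0 and continuity at
   zero. *)
pose l n := l' n + 1.
have l1 n : 1 <= l n by have [l0 _] := Hl' n; rewrite lerDr.
have Hl n f : K f -> (\int[leb]_(x in `]0%R, 1%R[) (excess f (l n) x)%:E <=
    (1 / (2 ^ n.+1)%:R)%:E)%E.
  move=> Kf; have [_ /(_ _ Kf)] := Hl' n; apply: le_trans.
  by apply: integral_excess_antitone; rewrite lerDl.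
pose F n u : \bar R := (Num.max (u - l n) 0)%:E.
have F0 n u : (0 <= F n u)%E by rewrite lee_fin le_max lexx orbT.
pose G u : \bar R := (\sum_(0 <= n <oo) F n u)%E.
have G_ge0 u : (0 <= G u)%E by exact: nneseries_ge0.
have Gsmall u : u <= 1 -> G u = 0%E.
  move=> u1; apply: eseries0 => n _ _; congr EFin.
  by apply/max_idPr; rewrite subr_le0 (le_trans u1).
exists G; split.
- split=> //.
  + exact: Gsmall.
  (* At this point the summand of index 0 equals 1. *)
  + exists (l 0%N + 1); first by rewrite addr_ge0// (le_trans _ (l1 0%N)).
    move=> G0; suff : (1 <= G (l 0%N + 1)%R)%E by rewrite G0 lee_fin ler10.
    have := @nneseries_lim_ge R (fun n => F n (l 0%N + 1)) xpredT 0 1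
      (fun n _ _ => F0 n _).
    by rewrite big_nat1; apply: le_trans; rewrite lee_fin le_max addrAC subrr add0r lexx.
  + move=> x y a x0 y0 a0 a1.
    have a1' : 0 <= 1 - a by rewrite subr_ge0.
    rewrite -nneseriesZl// -[X in (_ + X)%E]nneseriesZl// -nneseriesD//; last 2 first.
      by move=> n _ _; rewrite mule_ge0.
      by move=> n _ _; rewrite mule_ge0.
    apply: lee_nneseries => // n _; rewrite -!EFinM -EFinD lee_fin ge_max.
    apply/andP; split; last first.
      by rewrite addr_ge0// mulr_ge0// le_max lexx orbT.
    have -> : a * x + (1 - a) * y - l n = a * (x - l n) + (1 - a) * (y - l n) by lra.
    by apply: lerD; apply: ler_wpM2l => //; rewrite le_max lexx.
  + rewrite Gsmall//; apply: cvg_near_cst; near=> t.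
    by apply: Gsmall; near: t; exact: nbhs_right_le.
- apply/cvgeyPge => A.
  (* For t >= L the first M summands give at least M t - L >= (M - 1) t, and M - 1 = truncn |A| + 1
     exceeds A. *)
  pose M := (Num.truncn `|A|).+2.
  pose L := \sum_(0 <= n < M) l n.
  near=> t.
  have tL : L <= t by near: t; apply: nbhs_pinfty_ge; rewrite num_real.
  have t0 : 0 < t by near: t; apply: nbhs_pinfty_gt; rewrite num_real.
  rewrite lee_pdivlMr// -EFinM.
  have := @nneseries_lim_ge R (fun n => F n t) xpredT 0 M (fun n _ _ => F0 n _).
  apply: le_trans; rewrite sumEFin lee_fin.
  apply: (@le_trans _ _ (\sum_(0 <= n < M) (t - l n))); last first.
    by apply: ler_sum => n _; rewrite le_max lexx.
  rewrite sumrB sumr_const_nat subn0 -mulr_natl -/L.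
  apply: (@le_trans _ _ (M%:R * t - t)); last by rewrite lerB.
  rewrite -{3}[t]mul1r -mulrBl ler_pM2r// /M -[_.+2]addn1 natrD addrK.
  by rewrite (le_trans (ler_norm _))// ltW// truncnS_gt.
- apply: (@le_lt_trans _ _ 1%E); last exact: ltry.
  apply: ge_ereal_sup => _ [f Kf <-].
  (* Integrating termwise bounds the integral of G(|f|) by the sum of the 1 / 2^(n+1), which is at
     most 1. *)
  rewrite integral_nneseries//; last first.
    by move=> n; apply/measurable_EFinP; apply: measurable_excess;
      exact: measurable_L1 (KL1 _ Kf).
  apply: le_trans (epsilon_trick0 xpredT (@ler01 R)).
  apply: lee_nneseries => n; last by move=> _; exact: Hl.
  by move=> _ _; apply: integral_ge0.
Unshelve. all: by end_near. Qed.

(** * Uniform integrability and orbits *)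

(** Dominated convergence with dominating function |g|: at each x the excess is 0 once n >=
    |g(x)|. *)
Lemma integral_excess_cvg0 g : L1 g ->
  (\int[leb]_(x in `]0%R, 1%R[) (excess g n%:R x)%:E)%E @[n --> \oo] --> 0%E.
Proof.
move=> Lg; have mg := measurable_L1 Lg.
have mI : measurable I by exact: measurable_itv.
have [| | |_ _] := @dominated_convergence _ _ _ leb I mI
  (fun n x => (excess g n%:R x)%:E) (cst 0%E) (fun x => `|(g x)%:E|%E)
  (fun n => (measurable_EFinP _ _).2 (measurable_excess _ mg))
  (@measurable_cst _ _ _ _ _ _).
- apply: aeW => x _; apply: cvg_near_cst; near=> n; congr EFin.
  apply/max_idPr; rewrite subr_le0; near: n; exact: nbhs_infty_ger.
- exact: integrable_abse.
- apply: aeW => x n _; rewrite abse_EFin lee_fin ger0_norm ?excess_ge0//.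
  by rewrite -(excess0 g) excess_antitone.
- by rewrite integral0.
Unshelve. all: by end_near. Qed.

(** Where |f| > l, |f| is l plus the excess; elsewhere the excess vanishes. *)
Lemma excess_tail_integral f l : measurable_fun I f -> 0 <= l ->
  (\int[leb]_(x in [set x | I x /\ (l < `|f x|)%R]) `|f x|%:E =
   l%:E * tail I (fun x => `|f x|)%R l +
   \int[leb]_(x in `]0%R, 1%R[) (excess f l x)%:E)%E.
Proof.
move=> mf l0; set E := [set x | _].
have mI : measurable I by exact: measurable_itv.
have mE : measurable E by apply: measurable_level => //; exact: measurableT_comp.
have EI : E `<=` I by move=> x [].
have -> : (\int[leb]_(x in I) (excess f l x)%:E = \int[leb]_(x in E) (excess f l x)%:E)%E.
  rewrite -(setIidr EI) integral_mkcondr; apply: eq_integral => x /set_mem Ix.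
  rewrite patchE; case: ifPn => // /negP xE; congr EFin; apply/max_idPr.
  rewrite subr_le0 leNgt; apply/negP => lf; apply: xE; exact: mem_set.
rewrite /tail -/E -integral_cst// -ge0_integralD//; last 2 first.
- by move=> x _; rewrite lee_fin excess_ge0.
- apply/measurable_EFinP; apply: (measurable_funS mI EI).
  exact: measurable_excess.
apply: eq_integral => x /set_mem[_ lf] /=; rewrite -EFinD; congr EFin.
by rewrite /excess (max_idPl _) ?subr_ge0 ?ltW// addrC subrK.
Qed.

(** With E = {|f| > l} and t = m(E), l t + int (|f| - l)_+ = int_E |f| <= int_0^t mu(s, f) ds <=
    int_0^t mu(s, g) ds <= l t + int (|g| - l)_+. The term l t is finite and cancels, leaving a
    bound independent of [f]. *)
Lemma orbit_unif_integrable K g : L1 g -> K `<=` hlp_orbit g ->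
  unif_integrable K.
Proof.
move=> Lg Kg e e0; have mg := measurable_L1 Lg.
have mI : measurable I by exact: measurable_itv.
have [n gn] : exists n : nat,
    (\int[leb]_(x in `]0%R, 1%R[) (excess g n%:R x)%:E < e%:E)%E.
  have /fine_cvgP[gfin /cvgr_lt/(_ _ e0) ge] := integral_excess_cvg0 Lg.
  have [n [nfin ne]] := filter_ex (filterI gfin ge).
  by exists n; rewrite -(fineK nfin) lte_fin.
exists n%:R => // f Kf; have [Lf fg] := Kg _ Kf; have mf := measurable_L1 Lf.
set l : R := n%:R; have l0 : 0 <= l by [].
have maf : measurable_fun I (fun x => `|f x|) by exact: measurableT_comp.
have tfin : tail I (fun x => `|f x|) l \is a fin_num.
  rewrite ge0_fin_numE ?tail_ge0// (le_lt_trans (tail_le _ _ _))//.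
  by rewrite lebesgue_measure_itv0// ltry.
have t0 : 0 <= fine (tail I (fun x => `|f x|) l) by rewrite fine_ge0 ?tail_ge0.
have := excess_tail_integral mf l0; rewrite -(fineK tfin).
set t := fine _ in t0 * => fE.
have := fg t t0; under eq_integral do rewrite rearrangement_abs.
have : (\int[leb]_(x in [set x | I x /\ (l < `|f x|)%R]) `|f x|%:E <=
    \int[leb]_(s in `]0%R, t[) rearrangement s f)%E.
  apply: integral_le_rearrangement => //; [exact: measurable_level|by move=> x []|].
  by rewrite /t fineK.
move=> /le_trans/[apply]/le_trans/(_ (integral_rearrangement_le mg l0 t0)).
rewrite fE -EFinM leeD2lE// => /le_trans; apply; exact: ltW.
Qed.

(** * Series of step functions and the majorant *)

Implicit Types (a b : nat -> R).

(** On (0, 1) the half-lines act as the intervals (0, b n). Values are extended because the series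
    may diverge, for instance at x <= 0. *)
Definition step_series a b (x : R) : \bar R :=
  (\sum_(0 <= n <oo) (a n * \1_(`]-oo, b n[%classic : set R) x)%:E)%E.

Lemma step_series_ge0 a b x : (forall n, 0 <= a n) -> (0 <= step_series a b x)%E.
Proof. by move=> a0; apply: nneseries_ge0 => n _ _; rewrite lee_fin mulr_ge0. Qed.

Lemma measurable_step a b n (D : set R) :
  measurable_fun D (fun x => (a n * \1_(`]-oo, b n[%classic : set R) x)%:E).
Proof.
by apply/measurable_EFinP/measurable_funTS; apply: measurable_funM.
Qed.

Lemma integral_step_series a b (D : set R) : measurable D -> (forall n, 0 <= a n) ->
  (\int[leb]_(x in D) step_series a b x =
   \sum_(0 <= n <oo) (a n)%:E * leb (`]-oo, b n[ `&` D))%E.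
Proof.
move=> mD a0; rewrite integral_nneseries//; [|by move=> n; exact: measurable_step|
  by move=> n x _; rewrite lee_fin mulr_ge0].
apply: eq_eseriesr => n _; under eq_integral do rewrite EFinM.
rewrite ge0_integralZl//; last 2 first.
- by apply/measurable_EFinP; exact: measurable_indic.
- by rewrite lee_fin.
by rewrite integral_indic.
Qed.

Lemma integral_step_series_le a b : (forall n, 0 <= a n) -> (forall n, 0 <= b n) ->
  (\int[leb]_(x in I) step_series a b x <= \sum_(0 <= n <oo) (a n * b n)%:E)%E.
Proof.
move=> a0 b0; rewrite integral_step_series//.
apply: lee_nneseries => [n _ _|n _]; first by rewrite mule_ge0// lee_fin.
rewrite EFinM lee_wpmul2l ?lee_fin// -lebesgue_measure_itv0//.
apply: le_measure; rewrite ?inE//; first exact: measurableI.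
by move=> x [] /=; rewrite !in_itv/= => xb /andP[-> _].
Qed.

(** For x > 0 the indicator of x < b n is at most (b n)/x, so the series is at most 1/x times the
    sum of the a n b n. Finiteness thus holds at every such x, not only almost everywhere. *)
Lemma step_series_lty a b x : (forall n, 0 <= a n) -> (forall n, 0 <= b n) ->
  (\sum_(0 <= n <oo) (a n * b n)%:E < +oo)%E -> 0 < x ->
  (step_series a b x < +oo)%E.
Proof.
move=> a0 b0 aboo x0.
apply: (@le_lt_trans _ _ ((x^-1)%:E * \sum_(0 <= n <oo) (a n * b n)%:E)%E).
  rewrite -nneseriesZl; last by move=> n _; rewrite lee_fin mulr_ge0.
  apply: lee_nneseries => [n _ _|n _]; first by rewrite lee_fin mulr_ge0.
  rewrite -EFinM lee_fin mulrCA ler_wpM2l// indicE mem_setE in_itv/=.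
  case: (ltP x (b n)) => xb; last by rewrite mulr_ge0// invr_ge0 ltW.
  by rewrite mulrC ler_pdivlMr// mul1r ltW.
by rewrite lte_mul_pinfty// lee_fin invr_ge0 ltW.
Qed.

(** The steps of index k < n cover (0, u) entirely, step n covers (0, b n), and the later steps are
    dropped as nonnegative. *)
Lemma integral_step_series_ge a b n u : (forall k, 0 <= a k) -> 0 <= u ->
  (forall k, (k < n)%N -> u <= b k) -> 0 <= b n <= u ->
  ((\sum_(0 <= k < n) a k * u + a n * b n)%:E <=
   \int[leb]_(x in `]0%R, u[) step_series a b x)%E.
Proof.
move=> a0 u0 ub /andP[bn0 bnu]; rewrite integral_step_series//.
apply: le_trans (@nneseries_lim_ge R _ xpredT 0 n.+1 _); last first.
  by move=> k _ _; rewrite mule_ge0// lee_fin.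
rewrite big_nat_recr//= EFinD -sumEFin; apply: leeD.
  rewrite !big_nat; apply: lee_sum => k /andP[_ kn].
  rewrite EFinM lee_wpmul2l ?lee_fin// -lebesgue_measure_itv0//.
  apply: le_measure; rewrite ?inE//; first exact: measurableI.
  move=> x /=; rewrite !in_itv/= => /andP[x0 xu]; split; last by rewrite x0.
  exact: lt_le_trans (ub _ kn).
rewrite EFinM lee_wpmul2l ?lee_fin// -lebesgue_measure_itv0//.
apply: le_measure; rewrite ?inE//; first exact: measurableI.
move=> x /=; rewrite !in_itv/= => /andP[x0 xb]; rewrite x0 xb; split=> //=.
exact: lt_le_trans bnu.
Qed.

(** With [n] the least index such that b n <= t, and [F] the step series, int_0^t mu(s, f) ds <= l n
    t + c n <= int_0^min(t,1) F <= int_0^t mu(s, g) ds. *)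
Lemma unif_integrable_orbit (K : set (R -> R)) : K `<=` @L1 R -> L1bounded K ->
  unif_integrable K ->
  exists g : R -> R,
    [/\ L1 g, (forall x, x \in `]0, 1[ -> 0 <= g x) & K `<=` hlp_orbit g].
Proof.
move=> KL1 [M0 KM] UK; have mI : measurable I by exact: measurable_itv.
(* Chosen so that c 0 = e / 2 = |M0| + 1 bounds the L1-norms, that is, the excesses over level 0. *)
pose e := 2 * (`|M0| + 1).
have e0 : 0 < e by rewrite mulr_gt0// ltr_wpDl.
pose c n : R := e / (2 ^ n.+1)%:R.
have c0 n : 0 < c n by rewrite divr_gt0// ltr0n expn_gt0.
have [l [l00 l0 Kl]] : exists l : nat -> R, [/\ l 0%N = 0, forall n, 0 <= l n &
    forall n f, K f ->
    (\int[leb]_(x in `]0%R, 1%R[) (excess f (l n) x)%:E <= (c n)%:E)%E].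
  have [l' Hl'] := unif_integrable_seq UK e0.
  (* Level 0 is reset to 0: for t >= b 0 no step precedes step 0, so the term l 0 * t has to
     vanish. *)
  exists (fun n => if n is 0%N then 0 else l' n); split => //.
    by case=> // n; have [] := Hl' n.+1.
  case=> [f Kf|n f Kf]; last by have [_] := Hl' n.+1; exact.
  under eq_integral do rewrite excess0.
  apply: le_trans (KM _ Kf) _; rewrite lee_fin /c /e expn1 mulrAC divff// mul1r.
  by rewrite (le_trans (ler_norm _))// lerDl.
(* [a 0 + ... + a (n - 1) >= l n] makes the step functions dominate
   [l n * t + c n] for [t] in [[b n, b (n - 1)[]; the summand [1] forces
   [b n -> 0] and the summand [c n] forces [b n <= 1]. *)
pose a n := l n.+1 + 1 + c n.
have a1 n : 1 <= a n by rewrite /a -addrA addrCA lerDl addr_ge0// ltW.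
have a_gt0 n : 0 < a n by exact: lt_le_trans (a1 n).
have a0 n : 0 <= a n by exact: ltW.
pose b n := c n / a n.
have b0 n : 0 <= b n by rewrite ltW// divr_gt0.
have b1 n : b n <= 1.
  by rewrite ler_pdivrMr// mul1r /a lerDr addr_ge0.
have ab n : a n * b n = c n by rewrite mulrCA divff ?mulr1// gt_eqF.
have sum_ab : (\sum_(0 <= n <oo) (a n * b n)%:E < +oo)%E.
  under eq_eseriesr do rewrite ab.
  by rewrite (le_lt_trans (epsilon_trick0 xpredT (ltW e0)))// ltry.
pose F := step_series a b.
have F0 x : (0 <= F x)%E by exact: step_series_ge0.
have Ffin x : I x -> F x \is a fin_num.
  rewrite /= in_itv/= => /andP[x0 _].
  by rewrite ge0_fin_numE//; exact: step_series_lty.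
have FE : {in I, EFin \o (fine \o F) =1 F} by move=> x /set_mem /Ffin /fineK.
pose g := fine \o F.
have Lg : L1 g.
  apply: (@eq_integrable _ _ _ leb I mI F); first by move=> x /FE /esym.
  apply/integrableP; split.
    by apply: ge0_emeasurable_sum => // [k x _ _|k _];
      [rewrite lee_fin mulr_ge0|exact: measurable_step].
  under eq_integral do rewrite gee0_abs//.
  exact: le_lt_trans (integral_step_series_le a0 b0) sum_ab.
exists g; split => //; first by move=> x _; exact: fine_ge0.
move=> f Kf; split; first exact: KL1.
move=> t t0; under eq_integral do rewrite rearrangement_abs.
have [->|tn0] := eqVneq t 0; first by rewrite !set_itvoo0 !integral_set0.
have t_gt0 : 0 < t by rewrite lt_neqAle eq_sym tn0.
have exb : exists n, b n <= t.
  (* Here e / t < n + 1 <= 2^(n+1) gives c n <= t, and b n <= c n because a n >= 1. *)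
  exists (Num.truncn (e / t)); set n := Num.truncn _.
  apply: (@le_trans _ _ (c n)); first by rewrite ler_pdivrMr// ler_peMr// ltW.
  rewrite /c ler_pdivrMr ?ltr0n ?expn_gt0// mulrC -ler_pdivrMr//.
  apply: ltW; apply: lt_le_trans (truncnS_gt _) _.
  by rewrite ler_nat ltnW// ltn_expl.
case: (ex_minnP exb) => n bnt nmin.
have tb k : (k < n)%N -> t < b k.
  by move=> kn; rewrite ltNge; apply/negP => /nmin; rewrite leqNgt kn.
(* The majorant is integrated inside (0, 1) only, whereas t may exceed 1; b n <= 1 keeps step n
   inside (0, u). *)
pose u := Num.min t 1.
have u0 : 0 <= u by rewrite le_min t0 ler01.
apply: le_trans (integral_rearrangement_le (measurable_L1 (KL1 _ Kf)) (l0 n) t0) _.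
apply: (@le_trans _ _ (\int[leb]_(x in `]0%R, u[) F x)%E).
  apply: le_trans (integral_step_series_ge a0 u0 _ _); last 2 first.
  - by move=> k /tb /ltW; apply: le_trans; rewrite ge_min lexx.
  - by rewrite b0 le_min bnt b1.
  rewrite EFinD; apply: leeD; last by rewrite ab; exact: Kl.
  (* At a successor index, t < b 0 <= 1 gives u = t, and the last summand [a n] alone is already at
     least [l n.+1]. *)
  rewrite lee_fin; case: n {bnt nmin} tb => [|n] tb.
    by rewrite l00 mul0r big_nil.
  have tu : u = t by apply/min_idPl; rewrite ltW// (lt_le_trans (tb 0%N _)).
  rewrite tu big_nat_recr//= -[leLHS]add0r; apply: lerD.
    by apply: sumr_ge0 => k _; rewrite mulr_ge0.
  by rewrite ler_wpM2r// /a -addrA lerDl addr_ge0// ltW.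
have uI : `]0, u[%classic `<=` I.
  move=> x /=; rewrite !in_itv/= => /andP[-> /lt_le_trans]; apply.
  by rewrite ge_min lexx orbT.
have -> : (\int[leb]_(x in `]0%R, u[) F x = \int[leb]_(x in `]0%R, u[) `|g x|%:E)%E.
  apply: eq_integral => x /set_mem/uI Ix.
  by rewrite ger0_norm ?fine_ge0// fineK// Ffin.
apply: integral_le_rearrangement => //; first exact: measurable_L1.
by rewrite lebesgue_measure_itv0// lee_fin ge_min lexx.
Qed.

End HardyLittlewoodPolyaOrbits.

Theorem theorem3p5 (R : realType) (K : set (R -> R))
    (KL1 : K `<=` @L1 R) (Kbdd : L1bounded K) :
  (exists G : R -> \bar R,
    [/\ orlicz G,
        (G t * (t^-1)%:E)%E @[t --> +oo%R] --> +oo%E &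
        (ereal_sup
           [set \int[@lebesgue_measure R]_(s in `]0%R, 1%R[) G `|f s|%R
             | f in K] < +oo)%E])
  <->
  (exists g : R -> R,
    [/\ L1 g, (forall x, x \in `]0, 1[ -> 0 <= g x) & K `<=` hlp_orbit g]).
Proof.
split=> [[G [oG Goo Gsup]]|[g [Lg _ Kg]]].
  apply: unif_integrable_orbit => //.
  exact: orlicz_unif_integrable KL1 oG Goo Gsup.
by apply: unif_integrable_orlicz => //; exact: orbit_unif_integrable Lg Kg.
Qed.
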